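(* Let $G$ be a baseline cdf with pdf $g$, let $a,b,m,n>0$, and let $T$ have the $BKw\text{-}G$ distribution with parameters $a,b,m,n$. Put $$\beta'_j=\frac{(-1)^{j+1}}{B(m,n)\,(j+n)}\binom{m-1}{j},\qquad \beta_j=\beta'_j\,(j+n),\qquad \eta_l=\sum_{j=0}^{m-1}(-1)^l\,\beta_j\binom{j+n-1}{l},$$ and $$\Gamma_{p,q,r}=\int_{-\infty}^{\infty}t^p\left[1-\{1-G(t)^a\}^b\right]^q\left[\{1-G(t)^a\}^b\right]^r ab\,g(t)G(t)^{a-1}[1-G(t)^a]^{b-1}\,dt ,$$ which is the $(p,q,r)$-th probability weighted moment of the $Kw\text{-}G(a,b)$ distribution. Then the $s$-th moment of $T$ can be written either as $$E(T^s)=\sum_{j=0}^{m-1}\beta_j\,\Gamma_{s,0,j+n-1}$$ or as $$E(T^s)=\sum_{l=0}^{m+n-2}\eta_l\,\Gamma_{s,l,0}.$$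
   Context: $G$ is the cdf of a baseline distribution, with pdf $g(t)=\frac{d}{dt}G(t)$, $t>0$. $B(m,n)$ is the beta function, and $\binom{x}{k}=x(x-1)\cdots(x-k+1)/k!$ is the binomial coefficient. The $(p,q,r)$-th probability weighted moment of a random variable with cdf $F$ and pdf $f$ is $\int_{-\infty}^{\infty}t^pF(t)^q[1-F(t)]^rf(t)\,dt$. The Kumaraswamy-$G$ distribution $Kw\text{-}G(a,b)$ has cdf $1-[1-G(t)^a]^b$ and pdf $ab\,g(t)G(t)^{a-1}[1-G(t)^a]^{b-1}$. The Beta Kumaraswamy-$G$ ($BKw\text{-}G$) distribution with parameters $a,b,m,n>0$ has pdf $$f^{BKwG}(t;a,b,m,n)=\frac{ab\,g(t)G(t)^{a-1}[1-G(t)^a]^{bn-1}\left[1-[1-G(t)^a]^b\right]^{m-1}}{B(m,n)},\qquad 0<t<\infty .$$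
   Formalization: The sign of β_j is corrected to β_j = -β'_j(j+n), as the printed one gives E(T^0) = -1 for m=n=1; m (and n in the second formula) is a natural number so the sums make sense, and E(T^s), resp. the Γ_{s,l,0}, are assumed finite. *)

(* Defs.v *)
From HB Require Import structures.
From mathcomp Require Import all_boot all_order all_algebra.
From mathcomp Require Import all_classical all_reals all_analysis.
Set Implicit Arguments.
Unset Strict Implicit.
Unset Printing Implicit Defensive.
Import Order.TTheory GRing.Theory Num.Theory.
Import numFieldNormedType.Exports.
Local Open Scope classical_set_scope.
Local Open Scope ring_scope.

(* All real powers are taken with [powR]. Its convention 0 `^ x = 0 for x <> 0
   only matters where G is 0 or 1, and there the baseline density g vanishes
   almost everywhere. *)

Definition is_pdf (R : realType) (mu : set R -> \bar R) (f : R -> R) : Prop :=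
  [/\ measurable_fun [set: R] f,
      forall t, 0 <= f t &
      forall A : set R, measurable A ->
        mu A = (\int[lebesgue_measure]_(t in A) (f t)%:E)%E].

(* The library's [beta_fun] only takes natural arguments. *)
Definition Beta (R : realType) (x y : R) : R :=
  (\int[lebesgue_measure]_(t in `]0%R, 1%R[)
     (t `^ (x - 1) * (1 - t) `^ (y - 1)))%R.

Definition gbinom (R : realType) (x : R) (k : nat) : R :=
  (\prod_(i < k) (x - i%:R)) / k`!%:R.

Definition pwm (R : realType) (F f : R -> R) (p : nat) (q r : R) : \bar R :=
  (\int[lebesgue_measure]_t
     (t ^+ p * F t `^ q * (1 - F t) `^ r * f t)%:E)%E.

Section BetaKumaraswamyG.
Context (R : realType).
Implicit Types (G g : R -> R) (a b m n t q r : R).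

Definition kw_cdf G a b t : R := 1 - (1 - G t `^ a) `^ b.

Definition kw_pdf G g a b t : R :=
  a * b * g t * G t `^ (a - 1) * (1 - G t `^ a) `^ (b - 1).

Definition bkwg_pdf G g a b m n t : R :=
  if 0 < t then
    a * b * g t * G t `^ (a - 1) * (1 - G t `^ a) `^ (b * n - 1)
    * (1 - (1 - G t `^ a) `^ b) `^ (m - 1) / Beta m n
  else 0.

Definition bkw_beta' m n (j : nat) : R :=
  (-1) ^+ j.+1 / (Beta m n * (j%:R + n)) * gbinom (m - 1) j.

(* With [S := (1 - G `^ a) `^ b], for integer m the cdf of BKw-G is
     \sum_(j < m) bkw_beta' m n j * (S `^ (j + n) - 1).
   Since S is the survival function of Kw-G(a, b), S' = - kw_pdf, so
   differentiation gives the coefficient - bkw_beta' m n j * (j + n) of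
   S `^ (j + n - 1) * kw_pdf. The minus sign is necessary: without it,
   m = n = 1 and s = 0 would give E(T^0) = -1. *)
Definition bkw_beta m n (j : nat) : R := - (bkw_beta' m n j * (j%:R + n)).

(* The sum over j = 0, ..., m - 1 requires m to be a natural number. *)
Definition bkw_eta (m : nat) n (l : nat) : R :=
  \sum_(j < m) (-1) ^+ l * bkw_beta m%:R n j * gbinom (j%:R + n - 1) l.

Definition kw_Gamma G g a b (p : nat) q r : \bar R :=
  (\int[lebesgue_measure]_t
     (t ^+ p * (1 - (1 - G t `^ a) `^ b) `^ q * ((1 - G t `^ a) `^ b) `^ r
      * (a * b * g t * G t `^ (a - 1) * (1 - G t `^ a) `^ (b - 1)))%:E)%E.

End BetaKumaraswamyG.

(* Main.v *)
Require Import Defs.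
From HB Require Import structures.
From mathcomp Require Import all_boot all_order all_algebra.
From mathcomp Require Import all_classical all_reals all_analysis.
From mathcomp Require Import measurable_realfun.
From mathcomp Require Import ring lra zify.
Set Implicit Arguments.
Unset Strict Implicit.
Unset Printing Implicit Defensive.
Import Order.TTheory GRing.Theory Num.Theory.
Import numFieldNormedType.Exports.
Local Open Scope classical_set_scope.
Local Open Scope ring_scope.

(** Write S = (1 - G `^ a) `^ b for the survival function of Kw-G(a, b) and k
    for its density. Where 0 < G < 1, the BKw-G density is
    S `^ (n - 1) (1 - S) `^ (m - 1) k / Beta m n. For integer m, expanding
    (1 - S) ^+ (m - 1) by the binomial theorem gives
    \sum_j bkw_beta m n j * S `^ (j + n - 1) * k ([bkwg_expand]); if n is an
    integer too, expanding S ^+ (j + n - 1) in powers of 1 - S gives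
    \sum_l bkw_eta m n l * (1 - S) ^+ l * k ([bkwg_expand_nat]). Multiplying by
    t ^+ s and integrating term by term yields both formulas, since
    E(T ^ s) is the integral of t ^+ s against the density ([moment_pdf]).

    Three points need an argument.
    - The identities may fail where G is 0 or 1, because of the conventions for
      powers of 0. There G has an extremum, so its derivative g vanishes as soon
      as it exists, that is, almost everywhere ([ae_pdf_support]).
    - Term by term integration needs every term to be integrable. In the second
      formula all the Gamma are assumed finite. In the first one only T ^ s is
      integrable, and the factor (1 - S) ^+ (m - 1) of the density can be
      small, but only for small t. Beyond a point t0 with G t0 > 0 it is bounded
      below, so each term is at most a multiple of t ^+ s times the BKw-G
      density; before t0, t ^+ s is at most t0 ^+ s, and it remains to integrate
      S `^ (n - 1) k alone ([integrable_kw_term]).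
    - S `^ (n - 1) k is integrable ([integrable_kw_core]) because, up to the
      factor n, it is almost everywhere the derivative of the nondecreasing
      function 1 - S `^ n with values in [0, 1], and by Fatou's lemma applied
      to difference quotients such a derivative has a finite integral
      ([integral_derivative_le]). *)

(** * Densities and moments *)

(** A density in the sense of [is_pdf] agrees almost everywhere with the
    Radon-Nikodym derivative, whose change of variables formula applies. *)
Lemma ge0_integral_pdf (R : realType)
    (nu : {finite_measure set (measurableTypeR R) -> \bar R}) (f : R -> R)
    (phi : R -> \bar R) :
  is_pdf nu f -> measurable_fun [set: R] phi -> (forall t, 0 <= phi t)%E ->
  (\int[nu]_t phi t = \int[lebesgue_measure]_t (phi t * (f t)%:E))%E.
Proof.
move=> [mf f0 nuE] mphi phi0.
have mfE : measurable_fun [set: R] (EFin \o f) by exact/measurable_EFinP.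
have dom : nu `<< (@lebesgue_measure R).
  apply/null_content_dominatesP => A mA A0; rewrite nuE//.
  by apply: null_set_integral => //; exact: measurable_funTS.
rewrite -(Radon_Nikodym_SigmaFinite.change_of_variables dom)//.
have mrn : measurable_fun [set: R]
    (Radon_Nikodym_SigmaFinite.f nu (@lebesgue_measure R)).
  exact: measurable_int (Radon_Nikodym_SigmaFinite.f_integrable dom).
apply: ae_eq_integral => //; [exact: emeasurable_funM..|].
apply: ae_eqe_mul2l.
apply: integral_ae_eq => //.
- exact: Radon_Nikodym_SigmaFinite.f_integrable.
- by move=> A _ mA; rewrite -Radon_Nikodym_SigmaFinite.f_integral// -nuE.
Qed.

(** The positive and negative parts of [phi] are transported separately;
    multiplication by [f >= 0] commutes with taking them. *)
Lemma integral_pdf (R : realType)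
    (nu : {finite_measure set (measurableTypeR R) -> \bar R}) (f phi : R -> R) :
  is_pdf nu f -> measurable_fun [set: R] phi ->
  (\int[nu]_t (phi t)%:E = \int[lebesgue_measure]_t (phi t * f t)%:E)%E.
Proof.
move=> fpdf mphi; have [_ f0 _] := fpdf.
have mphiE : measurable_fun [set: R] (EFin \o phi) by exact/measurable_EFinP.
rewrite [LHS]integralE [RHS]integralE.
rewrite !(ge0_integral_pdf fpdf)//;
  [|exact: measurable_funeneg|exact: measurable_funepos].
congr (_ - _)%E; apply: eq_integral => t _;
  rewrite ?funeposE ?funenegE -?EFinN -!EFin_max -EFinM maxr_pMl// mul0r ?mulNr//.
Qed.

(** The sequence may have any sign, which gives access to the quotients on
    either side. *)
Lemma is_derive_cvg_seq (R : realType) (F : R -> R) (t l : R) (u : R^nat) :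
  is_derive (t : R^o) (1 : R^o) (F : R^o -> R^o) l ->
  (forall k, u k != 0) -> u k @[k --> \oo] --> 0 ->
  (u k)^-1 * (F (t + u k) - F t) @[k --> \oo] --> l.
Proof.
move=> [dF <-] u0 cu.
have cu' : u k @[k --> \oo] --> 0^'.
  move=> A /cu nA; have {}nA : \forall k \near \oo, u k != 0 -> A (u k) by exact: nA.
  by apply: filterS nA => k; apply; exact: u0.
have := cvg_comp _ _ cu' dF.
rewrite -/(derive _ _ _); apply: cvg_trans; apply: near_eq_cvg; near=> k => /=.
by rewrite [_ *: (1 : R^o)]mulr1 [(t + _)]addrC.
Unshelve. all: by end_near. Qed.

(** [lebesgue_measure] lives on [measurableTypeR R], which has the Borel sets of
    [R] under another display, so the law of [T] is first read there. *)
Lemma moment_pdf (R : realType) (d : measure_display)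
    (Omega : measurableType d) (P : probability Omega R) (T : {RV P >-> R})
    (f : R -> R) (s : nat) : is_pdf (distribution P T) f ->
  ('E_P[fun w => (T w ^+ s)%R] = \int[lebesgue_measure]_t (t ^+ s * f t)%:E)%E
  /\ (P.-integrable [set: Omega] (fun w => (T w ^+ s)%:E) ->
      lebesgue_measure.-integrable [set: R] (fun t => (t ^+ s * f t)%:E)).
Proof.
have mT : measurable_fun [set: Omega] (T : Omega -> measurableTypeR R).
  exact: (measurable_funPT T).
pose T' : {mfun Omega >-> measurableTypeR R} :=
  HB.pack (T : Omega -> measurableTypeR R)
    (isMeasurableFun.Build _ _ _ _ (T : Omega -> measurableTypeR R) mT).
rewrite -[distribution P T]/(distribution P T' : set R -> _) => fpdf.
have [mf f0 _] := fpdf.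
have mX : measurable_fun [set: R] (fun t : R => t ^+ s) by exact: measurable_funX.
have mXE : measurable_fun [set: measurableTypeR R] (fun t : R => (t ^+ s)%:E).
  by apply/measurable_EFinP.
have mnX : measurable_fun [set: measurableTypeR R] (fun t : R => `|t ^+ s|%:E).
  by apply/measurable_EFinP; exact: measurableT_comp.
have push (phi : measurableTypeR R -> \bar R) :
    measurable_fun [set: measurableTypeR R] phi -> (forall t, 0 <= phi t)%E ->
    (\int[distribution P T']_t phi t = \int[P]_w phi (T w))%E.
  by move=> mphi phi0; rewrite ge0_integral_pushforward.
split.
  rewrite -(integral_pdf fpdf mX).
  rewrite unlock [LHS]integralE [RHS]integralE !push//.
  - by congr (_ - _)%E; apply: eq_integral => w _; rewrite ?funeposE ?funenegE.
  - exact: measurable_funeneg.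
  - exact: measurable_funepos.
move=> /integrableP[_ fin]; apply/integrableP; split.
  by apply/measurable_EFinP; exact: measurable_funM.
apply: le_lt_trans fin.
rewrite [leRHS](_ : _ = (\int[distribution P T']_t `|t ^+ s|%:E)%E); last first.
  by rewrite push.
rewrite (ge0_integral_pdf fpdf)//.
rewrite le_eqVlt; apply/orP; left; apply/eqP; apply: eq_integral => t _.
by rewrite /= normrM (ger0_norm (f0 t)).
Qed.

(** * Derivatives of bounded monotone functions *)

(** With K = k.+1 and t in the cell [[i / K, (i + 1) / K[], monotonicity bounds
    the increment by F ((i + 2) / K) - F (i / K). The cell has length 1 / K,
    which cancels the factor K, and the sum of these bounds telescopes to at
    most twice the oscillation of [F]. *)
Lemma integral_increment_le (R : realType) (F : R -> R) (k : nat) :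
  {homo F : x y / x <= y} -> (forall x, 0 <= F x <= 1) ->
  (\int[lebesgue_measure]_(t in `]0%R, +oo[)
     (k.+1%:R * (F (t + k.+1%:R^-1) - F t))%:E <= 2%:E)%E.
Proof.
move=> ndF F01; set K : R := k.+1%:R; have K0 : 0 < K by rewrite ltr0n.
have mF : measurable_fun [set: R] F by exact: nondecreasing_measurable.
pose q t := K * (F (t + K^-1) - F t).
have q0 t : 0 <= q t.
  by rewrite mulr_ge0 ?(ltW K0)// subr_ge0 ndF// lerDl invr_ge0 ltW.
have q0E t : (0 <= (q t)%:E)%E by rewrite lee_fin.
have mq : measurable_fun [set: measurableTypeR R] (EFin \o q).
  apply/measurable_EFinP; apply: measurable_funM => //.
  apply: measurable_funB => //; apply: measurableT_comp => //.
  exact: measurable_funD.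
pose cell (i : nat) : set (measurableTypeR R) := `[i%:R / K, i.+1%:R / K[%classic.
have cellP i t : cell i t = (i%:R <= K * t < i.+1%:R).
  by rewrite /cell/= in_itv/= ler_pdivrMr// ltr_pdivlMr// mulrC.
have mcell i : measurable (cell i) by exact: measurable_itv.
have trivcell : trivIset [set: nat] cell.
  move=> i j _ _ [t [] /=]; rewrite !cellP.
  by move=> /truncn_def <- /truncn_def <-.
apply: (@le_trans _ _ (\int[lebesgue_measure]_(t in \bigcup_i cell i) (q t)%:E)%E).
  apply: ge0_subset_integral => //.
  - exact: (bigcup_measurable (fun k _ => mcell k)).
  - exact: measurable_funTS.
  - by move=> t _; exact: q0E.
  - move=> t /=; rewrite in_itv/= andbT => t0; exists (Num.truncn (K * t)) => //.
    by rewrite cellP truncn_itv// mulr_ge0 ?ltW.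
rewrite ge0_integral_bigcup//; last exact: measurable_funTS.
have cell_le i : (\int[lebesgue_measure]_(t in cell i) (q t)%:E <=
    (F (i.+2%:R / K) - F (i%:R / K))%:E)%E.
  apply: (@le_trans _ _ (\int[lebesgue_measure]_(t in cell i)
      (cst (K * (F (i.+2%:R / K) - F (i%:R / K)))%:E t))%E).
    apply: ge0_le_integral => //.
    - exact: measurable_funTS.
    - move=> t; rewrite cellP => /andP[t0 t1]; rewrite lee_fin ler_pM2l// lerB//.
        apply: ndF; rewrite -[i.+2]addn1 natrD mulrDl mul1r lerD2r.
        by rewrite ler_pdivlMr// mulrC ltW.
      by apply: ndF; rewrite ler_pdivrMr// mulrC.
  rewrite integral_cst// [X in (_ * X)%E](_ : _ = (K^-1)%:E); last first.
    rewrite /cell /= lebesgue_measure_itv/= lte_fin ltr_pM2r ?invr_gt0// ltr_nat ltnS leqnn.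
    by rewrite -EFinD -mulrBl -natrB ?leqnSn// subSnn mul1r.
  by rewrite -EFinM mulrAC mulfV ?gt_eqF// mul1r.
apply: lime_le.
  by apply: is_cvg_nneseries => i _ _; apply: integral_ge0 => t _; rewrite lee_fin.
apply: nearW => N.
apply: (@le_trans _ _ (\sum_(0 <= i < N) (F (i.+2%:R / K) - F (i%:R / K))%:E)%E).
  exact: lee_sum.
rewrite sumEFin lee_fin.
have -> : \sum_(0 <= i < N) (F (i.+2%:R / K) - F (i%:R / K)) =
    F (N.+1%:R / K) + F (N%:R / K) - F (1%:R / K) - F (0%:R / K).
  elim: N => [|N IH]; first by rewrite big_nil; ring.
  by rewrite big_nat_recr//= IH; ring.
by have := F01 (N.+1%:R / K); have := F01 (N%:R / K); have := F01 (1%:R / K);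
  have := F01 (0%:R / K); lra.
Qed.

(** Fatou's lemma for the difference quotients of [F], whose integrals are at
    most 2 by [integral_increment_le]. Where [h] vanishes [F] need not be
    differentiable, since the lower limit of the quotients is nonnegative in
    any case. *)
Lemma integral_derivative_le (R : realType) (F h : R -> R) :
  {homo F : x y / x <= y} -> (forall x, 0 <= F x <= 1) ->
  measurable_fun [set: R] h -> (forall x, 0 <= h x) ->
  {ae (@lebesgue_measure R), forall t : R, 0 < t ->
     h t = 0 \/ is_derive (t : R^o) (1 : R^o) (F : R^o -> R^o) (h t)} ->
  (\int[lebesgue_measure]_(t in `]0%R, +oo[) (h t)%:E <= 2%:E)%E.
Proof.
move=> ndF F01 mh h0 aeF.
have mF : measurable_fun [set: R] F by exact: nondecreasing_measurable.
pose q (k : nat) t := (k.+1%:R * (F (t + k.+1%:R^-1) - F t))%:E.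
have q0 k t : (0 <= q k t)%E.
  by rewrite lee_fin mulr_ge0// subr_ge0 ndF// lerDl invr_ge0.
have mq k : measurable_fun [set: measurableTypeR R] (q k).
  apply/measurable_EFinP; apply: measurable_funM => //.
  apply: measurable_funB => //; apply: measurableT_comp => //.
  exact: measurable_funD.
have le_lim : (\int[lebesgue_measure]_(t in `]0%R, +oo[) (h t)%:E <=
    \int[lebesgue_measure]_(t in `]0%R, +oo[) limn_einf (q ^~ t))%E.
  have lim0 t : (0 <= limn_einf (q ^~ t))%E.
    rewrite limn_einf_lim; apply: lime_ge; first exact: is_cvg_einfs.
    by apply: nearW => k; apply: le_ereal_inf_tmp => _ [j _ <-].
  apply: ae_ge0_le_integral => //.
  - by move=> t _; rewrite lee_fin.
  - by apply/measurable_funTS/measurable_EFinP.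
  - apply: (emeasurable_fun_cvg (fun k t => einfs (q ^~ t) k)).
      by move=> k; apply: measurable_funTS; exact: measurable_fun_einfs.
    by move=> t _; rewrite limn_einf_lim; exact: is_cvg_einfs.
  - move: aeF; apply: filterS.
      exact: (ae_filter_ringOfSetsType (@lebesgue_measure R)).
    move=> t aet /=; rewrite in_itv/= andbT => /aet[-> //|Dt].
    rewrite (_ : limn_einf _ = (h t)%:E)//.
    apply: (cvg_limn_einf_sup _).1; apply/cvg_EFin; first exact: nearW.
    have n0 k : (k.+1%:R^-1 : R) != 0 by rewrite invr_eq0 pnatr_eq0.
    have := is_derive_cvg_seq Dt n0 cvg_harmonic; under eq_fun do rewrite invrK.
    exact.
apply: (le_trans le_lim); apply: (le_trans (fatou _ _ _ _)) => //.
  by move=> k; exact: measurable_funTS.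
rewrite limn_einf_lim; apply: lime_le; first exact: is_cvg_einfs.
apply: nearW => k; apply: le_trans (integral_increment_le k ndF F01).
by apply: ereal_inf_lbound; exists k => /=.
Qed.

(** * Expansions of the density *)

Lemma gbinom_nat (R : realType) (k j : nat) :
  gbinom (k%:R : R) j = 'C(k, j)%:R.
Proof.
have prodE : \prod_(i < j) (k%:R - i%:R : R) = (k ^_ j)%:R.
  elim: j => [|j IH]; first by rewrite big_ord0 ffactn0.
  rewrite big_ord_recr/= IH ffactnSr natrM.
  have [jk|kj] := leqP j k; first by rewrite natrB.
  by rewrite ffact_small// !mul0r.
by rewrite /gbinom prodE -bin_ffact natrM mulfK// pnatr_eq0 -lt0n fact_gt0.
Qed.

Lemma bkw_betaE (R : realType) (m n : R) (j : nat) : 0 < n ->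
  bkw_beta m n j = (-1) ^+ j * gbinom (m - 1) j / Beta m n.
Proof.
move=> n0; have jn0 : j%:R + n != 0 by rewrite gt_eqF// ltr_wpDl.
rewrite /bkw_beta /bkw_beta' exprS invfM.
by move: (Beta m n)^-1 => iB; field.
Qed.

Lemma powR_natD (R : realType) (w r : R) (j : nat) : 0 < w ->
  w `^ (j%:R + r) = w ^+ j * w `^ r.
Proof.
move=> w0; rewrite powRD; last by rewrite (gt_eqF w0) implybT.
by rewrite powR_mulrn// ltW.
Qed.

Lemma powR_split (R : realType) (y b r : R) : 0 < y ->
  y `^ (b * r - 1) = (y `^ b) `^ (r - 1) * y `^ (b - 1).
Proof.
move=> y0; rewrite -powRrM -powRD; last by rewrite (gt_eqF y0) implybT.
by congr (_ `^ _); ring.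
Qed.

(** Where 0 < G < 1, this is S `^ (r - 1) times the Kw-G(a, b) density, for S the
    Kw-G(a, b) survival function; it is also 1 / r times the density of
    Kw-G(a, b * r). *)
Definition kw_core {R : realType} (G g : R -> R) (a b r t : R) : R :=
  a * b * g t * G t `^ (a - 1) * (1 - G t `^ a) `^ (b * r - 1).

(** The integrand of [kw_Gamma]. *)
Definition kw_term {R : realType} (G g : R -> R) (a b : R) (p : nat)
    (q r t : R) : R :=
  t ^+ p * (1 - (1 - G t `^ a) `^ b) `^ q * ((1 - G t `^ a) `^ b) `^ r
    * (a * b * g t * G t `^ (a - 1) * (1 - G t `^ a) `^ (b - 1)).

Lemma kw_surv_itv (R : realType) (u a b : R) : 0 < a -> 0 < b -> 0 < u < 1 ->
  0 < 1 - u `^ a < 1 /\ 0 < (1 - u `^ a) `^ b < 1.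
Proof.
move=> a0 b0 /andP[u0 u1].
have pow1 (x c : R) : 0 < c -> 0 < x < 1 -> 0 < x `^ c < 1.
  move=> c0 /andP[x0 x1]; rewrite powR_gt0//=.
  apply: (@lt_le_trans _ _ (1 `^ c)); last by rewrite powR1.
  by apply: gt0_ltr_powR; rewrite // ?nnegrE// ltW.
have : 0 < u `^ a < 1 by apply: pow1 => //; rewrite u0.
move=> /andP[ua0 ua1]; have y01 : 0 < 1 - u `^ a < 1 by apply/andP; lra.
by split=> //; exact: pow1.
Qed.

Lemma kw_term_split (R : realType) (G g : R -> R) (a b : R) (p : nat) (r t : R) :
  0 < a -> 0 < b -> g t = 0 \/ 0 < G t < 1 ->
  kw_term G g a b p 0 (r - 1) t = t ^+ p * kw_core G g a b r t.
Proof.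
move=> a0 b0 [gt0|G01]; first by rewrite /kw_term /kw_core gt0 !(mulr0, mul0r).
have [/andP[y0 _] _] := kw_surv_itv a0 b0 G01.
by rewrite /kw_term /kw_core powRr0 (powR_split _ _ y0); ring.
Qed.

Lemma bkwg_pdf_core (R : realType) (G g : R -> R) (a b n t : R) (M : nat) :
  0 < a -> 0 < b -> (0 < M)%N -> g t = 0 \/ 0 < t /\ 0 < G t < 1 ->
  bkwg_pdf G g a b M%:R n t =
  kw_core G g a b n t * (1 - (1 - G t `^ a) `^ b) ^+ M.-1 / Beta M%:R n.
Proof.
move=> a0 b0 M0 [gt0|[t0 G01]].
  by rewrite /bkwg_pdf /kw_core gt0 !(mulr0, mul0r); case: ifP.
have [_ /andP[w0 w1]] := kw_surv_itv a0 b0 G01.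
rewrite /bkwg_pdf t0 /kw_core.
have -> : M%:R - 1 = M.-1%:R :> R by rewrite -subn1 natrB.
by rewrite powR_mulrn// subr_ge0 ltW.
Qed.

(** Binomial expansion of (1 - S) ^+ (M - 1), each power of S being absorbed by
    [kw_core] through its parameter r = j + n. *)
Lemma bkwg_expand (R : realType) (G g : R -> R) (a b n t : R) (M s : nat) :
  0 < a -> 0 < b -> 0 < n -> (0 < M)%N -> g t = 0 \/ 0 < t /\ 0 < G t < 1 ->
  t ^+ s * bkwg_pdf G g a b M%:R n t =
  \sum_(j < M) bkw_beta M%:R n j * kw_term G g a b s 0 (j%:R + n - 1) t.
Proof.
move=> a0 b0 n0 M0 gt; rewrite bkwg_pdf_core//.
have gt' : g t = 0 \/ 0 < G t < 1 by case: gt => [|[]]; [left|right].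
under eq_bigr do rewrite kw_term_split//.
case: gt' => [gt0|G01].
  by rewrite /kw_core gt0 !(mulr0, mul0r) big1// => j _; rewrite !(mulr0, mul0r).
have [/andP[y0 _] /andP[w0 w1]] := kw_surv_itv a0 b0 G01.
have coreE (j : nat) : kw_core G g a b (j%:R + n) t =
    ((1 - G t `^ a) `^ b) ^+ j * kw_core G g a b n t.
  rewrite /kw_core !(powR_split _ _ y0) -addrA (powR_natD _ _ w0); ring.
under eq_bigr do rewrite coreE bkw_betaE//.
set w := (1 - G t `^ a) `^ b.
rewrite exprBn prednK// mulr_sumr mulr_suml mulr_sumr.
apply: eq_bigr => j _.
have -> : M%:R - 1 = M.-1%:R :> R by rewrite -subn1 natrB.
rewrite gbinom_nat expr1n mulr1 -mulr_natr; ring.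
Qed.

(** The expansion of w = 1 - (1 - w). The range of the sum may exceed [k], which
    lets all the powers S ^+ (j + N - 1), j < M, share the range l < M + N - 1
    when the two sums are exchanged. *)
Lemma powR_binomial (R : realType) (w : R) (k K : nat) : 0 < w < 1 -> (k < K)%N ->
  w `^ k%:R = \sum_(l < K) (-1) ^+ l * 'C(k, l)%:R * (1 - w) `^ l%:R.
Proof.
move=> /andP[w0 w1] kK; rewrite powR_mulrn ?ltW//.
rewrite (eq_bigr (fun l : 'I_K => (-1) ^+ l * 'C(k, l)%:R * (1 - w) ^+ l)); last first.
  by move=> l _; rewrite powR_mulrn// subr_ge0 ltW.
(* the terms of index above k vanish with their binomial coefficients *)
rewrite (bigID (fun l : 'I_K => (l < k.+1)%N))/= [X in _ + X]big1 ?addr0; last first.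
  by move=> l; rewrite -leqNgt => kl; rewrite bin_small// mulr0 mul0r.
rewrite -(big_ord_widen _ (fun l => (-1) ^+ l * 'C(k, l)%:R * (1 - w) ^+ l) kK).
rewrite -[in LHS](subKr 1 w) exprBn; apply: eq_bigr => l _.
by rewrite expr1n mulr1 -mulr_natr; ring.
Qed.

Lemma bkwg_expand_nat (R : realType) (G g : R -> R) (a b t : R) (M N s : nat) :
  0 < a -> 0 < b -> (0 < M)%N -> (0 < N)%N ->
  g t = 0 \/ 0 < t /\ 0 < G t < 1 ->
  t ^+ s * bkwg_pdf G g a b M%:R N%:R t =
  \sum_(l < (M + N - 2).+1)
     bkw_eta M N%:R l * kw_term G g a b s l%:R 0 t.
Proof.
move=> a0 b0 M0 N0 gt; rewrite bkwg_expand// ?ltr0n//.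
case: gt => [gt0|[t0 G01]].
  by rewrite !big1// => j _; rewrite /kw_term gt0 !(mulr0, mul0r).
have [/andP[y0 _] w01] := kw_surv_itv a0 b0 G01.
rewrite /bkw_eta; under [RHS]eq_bigr do rewrite mulr_suml.
rewrite exchange_big/=; apply: eq_bigr => j _.
have -> : j%:R + N%:R - 1 = (j + N).-1%:R :> R.
  by rewrite -natrD -subn1 natrB// addn_gt0 N0 orbT.
rewrite /kw_term (powR_binomial (K := (M + N - 2).+1) w01); last first.
  by have := ltn_ord j; lia.
rewrite powRr0 mulr1 mulr_sumr mulr_suml mulr_sumr.
apply: eq_bigr => l _; rewrite gbinom_nat powRr0.
have rearrange (be ts e c v k : R) :
    be * (ts * (e * c * v) * k) = e * be * c * (ts * v * 1 * k) by ring.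
exact: rearrange.
Qed.

(** * The baseline distribution *)

Lemma cdf_itv (R : realType) (G : cumulativeBounded (0 : R) (1 : R)) (t : R) :
  0 <= G t <= 1.
Proof.
have nd := cumulative_is_nondecreasing G.
apply/andP; split.
  apply: (cvgr_to_le (cumulativeNy G)).
  by near=> x; apply: nd; near: x; exact: nbhs_ninfty_le.
apply: (cvgr_to_ge (cumulativey G)).
by near=> x; apply: nd; near: x; exact: nbhs_pinfty_ge.
Unshelve. all: by end_near. Qed.

(** Beyond a maximum of a nondecreasing function all increments are zero, so the
    difference quotients along 1 / (k + 1) vanish; at a minimum those along
    - 1 / (k + 1) do. *)
Lemma derivative0_at_extremum (R : realType) (F : R -> R) (t l : R) :
  {homo F : x y / x <= y} ->
  is_derive (t : R^o) (1 : R^o) (F : R^o -> R^o) l ->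
  (forall x, F x <= F t) \/ (forall x, F t <= F x) -> l = 0.
Proof.
move=> ndF DF [maxF|minF].
  have n0 k : (k.+1%:R^-1 : R) != 0 by rewrite invr_eq0 pnatr_eq0.
  have := is_derive_cvg_seq DF n0 cvg_harmonic.
  rewrite (_ : (fun _ => _) = fun=> 0); last first.
    apply/funext => k; rewrite (_ : F _ = F t) ?subrr ?mulr0//.
    by apply/eqP; rewrite eq_le maxF ndF// lerDl invr_ge0.
  by move=> /(cvg_lim (@Rhausdorff R)) <-; rewrite lim_cst.
have n0 k : - (k.+1%:R^-1 : R) != 0 by rewrite oppr_eq0 invr_eq0 pnatr_eq0.
have cvgN : - (k.+1%:R^-1 : R) @[k --> \oo] --> 0.
  by rewrite -oppr0; apply: cvgN; exact: cvg_harmonic.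
have := is_derive_cvg_seq DF n0 cvgN.
rewrite (_ : (fun _ => _) = fun=> 0); last first.
  apply/funext => k; rewrite (_ : F (t - _) = F t) ?subrr ?mulr0//.
  by apply/eqP; rewrite eq_le minF ndF// gerBl invr_ge0.
by move=> /(cvg_lim (@Rhausdorff R)) <-; rewrite lim_cst.
Qed.

Lemma ae_lebesgueS (R : realType) (A B : R -> Prop) : (forall t, A t -> B t) ->
  {ae (@lebesgue_measure R), forall t, A t} ->
  {ae (@lebesgue_measure R), forall t, B t}.
Proof.
move=> AB; apply: filterS => //.
exact: (ae_filter_ringOfSetsType (@lebesgue_measure R)).
Qed.

(** Where G is 0 or 1 it has a minimum or a maximum, by [cdf_itv], so that g
    vanishes wherever it is the derivative of G. *)
Lemma ae_pdf_support (R : realType) (G : cumulativeBounded (0 : R) (1 : R))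
    (g : R -> R) : (forall t : R, t <= 0 -> g t = 0) ->
  {ae (@lebesgue_measure R), forall t : R, 0 < t ->
     is_derive (t : R^o) (1 : R^o) (G : R^o -> R^o) (g t)} ->
  {ae (@lebesgue_measure R), forall t : R, g t = 0 \/
     [/\ 0 < t, 0 < G t < 1 &
         is_derive (t : R^o) (1 : R^o) (G : R^o -> R^o) (g t)]}.
Proof.
move=> g0; apply: ae_lebesgueS => t Dt.
have [/g0 ->|t0] := leP t 0; [by left|have {}Dt := Dt t0].
have [/andP[G0 G1]] := cdf_itv G t.
have nd := cumulative_is_nondecreasing G.
have [Gt0|Gt0] := eqVneq (G t) 0.
  left; apply: (derivative0_at_extremum nd Dt); right => x.
  rewrite -[X in X <= _]/(G t) Gt0; by case/andP: (cdf_itv G x).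
have [Gt1|Gt1] := eqVneq (G t) 1.
  left; apply: (derivative0_at_extremum nd Dt); left => x.
  rewrite -[X in _ <= X]/(G t) Gt1; by case/andP: (cdf_itv G x).
by right; split; rewrite // !lt_neqAle eq_sym Gt0 G0 Gt1 G1.
Qed.

(** * Integrability of the terms *)

Lemma measurable_kw_surv (R : realType) (G : R -> R) (a b : R) :
  measurable_fun [set: R] G ->
  measurable_fun [set: R] (fun t => (1 - G t `^ a) `^ b).
Proof.
move=> mG; apply: (measurableT_comp (measurable_powR b)).
apply: measurable_funB => //.
exact: (measurableT_comp (measurable_powR a)).
Qed.

Lemma measurable_kw_core (R : realType) (G g : R -> R) (a b r : R) :
  measurable_fun [set: R] G -> measurable_fun [set: R] g ->
  measurable_fun [set: R] (kw_core G g a b r).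
Proof.
move=> mG mg; apply: measurable_funM; last exact: measurable_kw_surv.
apply: measurable_funM; last exact: (measurableT_comp (measurable_powR _)).
exact: measurable_funM.
Qed.

Lemma measurable_kw_term (R : realType) (G g : R -> R) (a b : R) (p : nat)
    (q r : R) :
  measurable_fun [set: R] G -> measurable_fun [set: R] g ->
  measurable_fun [set: R] (kw_term G g a b p q r).
Proof.
move=> mG mg; have mS := measurable_kw_surv a b mG.
apply: measurable_funM.
  apply: measurable_funM.
    apply: measurable_funM; first exact: measurable_funX.
    by apply: (measurableT_comp (measurable_powR _)); exact: measurable_funB.
  exact: (measurableT_comp (measurable_powR _)).
have -> : (fun t => a * b * g t * G t `^ (a - 1) * (1 - G t `^ a) `^ (b - 1)) =
    kw_core G g a b 1 by apply/funext => t; rewrite /kw_core mulr1.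
exact: measurable_kw_core.
Qed.

Lemma kw_core_ge0 (R : realType) (G g : R -> R) (a b r t : R) :
  0 < a -> 0 < b -> 0 <= g t -> 0 <= kw_core G g a b r t.
Proof.
by move=> a0 b0 gt; rewrite /kw_core !mulr_ge0 ?powR_ge0// ltW.
Qed.

Lemma is_derive_kw_cdf (R : realType) (G : R -> R) (g a c t : R) :
  0 < a -> 0 < c -> 0 < G t < 1 ->
  is_derive (t : R^o) (1 : R^o) (G : R^o -> R^o) g ->
  is_derive (t : R^o) (1 : R^o) ((fun x => 1 - (1 - G x `^ a) `^ c) : R^o -> R^o)
    (c * (1 - G t `^ a) `^ (c - 1) * (a * G t `^ (a - 1) * g)).
Proof.
move=> a0 c0 G01 DG; case/andP: (G01) => G0 _.
have [/andP[y0 _] _] := kw_surv_itv a0 c0 G01.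
have DGa : is_derive t 1 ((powR (R:=R))^~ a \o G) (a * G t `^ (a - 1) * g).
  by apply: is_derive1_comp; exact: is_derive1_powR.
have Dy : is_derive t 1 (cst 1 - ((powR (R:=R))^~ a \o G)) (0 - a * G t `^ (a - 1) * g).
  exact: is_deriveB.
have Dyc : is_derive t 1 ((powR (R:=R))^~ c \o (cst 1 - ((powR (R:=R))^~ a \o G)))
    (c * (1 - G t `^ a) `^ (c - 1) * (0 - a * G t `^ (a - 1) * g)).
  by apply: is_derive1_comp; exact: is_derive1_powR.
have : is_derive t 1 (cst 1 - ((powR (R:=R))^~ c \o (cst 1 - ((powR (R:=R))^~ a \o G))))
    (0 - c * (1 - G t `^ a) `^ (c - 1) * (0 - a * G t `^ (a - 1) * g)).
  exact: is_deriveB.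
by rewrite !sub0r mulrN opprK.
Qed.

Lemma kw_cdf_nondecreasing (R : realType) (G : R -> R) (a c : R) :
  {homo G : x y / x <= y} -> (forall x, 0 <= G x <= 1) -> 0 < a -> 0 < c ->
  {homo (fun x => 1 - (1 - G x `^ a) `^ c) : x y / x <= y}
  /\ forall x, 0 <= 1 - (1 - G x `^ a) `^ c <= 1.
Proof.
move=> ndG G01 a0 c0.
have le1 (x r : R) : 0 < r -> 0 <= x <= 1 -> 0 <= x `^ r <= 1.
  move=> r0 /andP[x0 x1]; rewrite powR_ge0/=.
  apply: (@le_trans _ _ (1 `^ r)); last by rewrite powR1.
  by apply: ge0_ler_powR; rewrite // ?nnegrE// ltW.
have y01 x : 0 <= 1 - G x `^ a <= 1.
  by have /andP[] := le1 _ _ a0 (G01 x); lra.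
split=> [x y xy|x]; last by have /andP[] := le1 _ _ c0 (y01 x); lra.
rewrite lerD2l lerN2; apply: ge0_ler_powR; rewrite ?(ltW c0)// ?nnegrE.
- by case/andP: (y01 y).
- by case/andP: (y01 x).
- rewrite lerD2l lerN2; apply: ge0_ler_powR; rewrite ?(ltW a0)// ?nnegrE.
  + by case/andP: (G01 x).
  + by case/andP: (G01 y).
  + exact: ndG.
Qed.

(** [r * kw_core] is almost everywhere the derivative of 1 - S `^ r, a
    nondecreasing function with values in [0, 1]; where g vanishes the latter
    may fail to be differentiable, but [kw_core] is zero. *)
Lemma integrable_kw_core (R : realType) (G : cumulativeBounded (0 : R) (1 : R))
    (g : R -> R) (a b r : R) :
  measurable_fun [set: R] g -> (forall t, 0 <= g t) ->
  (forall t : R, t <= 0 -> g t = 0) ->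
  {ae (@lebesgue_measure R), forall t : R, 0 < t ->
     is_derive (t : R^o) (1 : R^o) (G : R^o -> R^o) (g t)} ->
  0 < a -> 0 < b -> 0 < r ->
  lebesgue_measure.-integrable [set: R] (EFin \o kw_core G g a b r).
Proof.
move=> mg g0 gneg DG a0 b0 r0.
have ndG := cumulative_is_nondecreasing G.
have mG : measurable_fun [set: R] G by exact: nondecreasing_measurable.
have [ndF F01] := kw_cdf_nondecreasing ndG (cdf_itv G) a0 (mulr_gt0 b0 r0).
have mcore := measurable_kw_core a b r mG mg.
have core0 t : 0 <= kw_core G g a b r t by exact: kw_core_ge0.
have bound : (\int[lebesgue_measure]_(t in `]0%R, +oo[)
    (r * kw_core G g a b r t)%:E <= 2%:E)%E.
  apply: (integral_derivative_le ndF F01).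
  - exact: measurable_funM.
  - by move=> t; rewrite mulr_ge0// ltW.
  - have := ae_pdf_support gneg DG; apply: ae_lebesgueS => t [gt0|[_ G01 D]] _.
      by left; rewrite /kw_core gt0 !(mulr0, mul0r).
    right; have := is_derive_kw_cdf a0 (mulr_gt0 b0 r0) G01 D.
    by congr (is_derive _ _ _ _); rewrite /kw_core; ring.
rewrite -[EFin \o _](_ : (fun t => (r^-1)%:E * (r * kw_core G g a b r t)%:E)%E = _);
  last by apply/funext => t /=; rewrite -EFinM mulrA mulVf ?gt_eqF// mul1r.
apply: integrableZl => //; apply/integrableP; split.
  by apply/measurable_EFinP; exact: measurable_funM.
apply: le_lt_trans (ltry 2); apply: le_trans bound.
rewrite [leRHS]integral_mkcond le_eqVlt; apply/orP; left; apply/eqP.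
apply: eq_integral => t _; rewrite patchE /=.
have [t0|t0] := leP t 0.
  rewrite memNset; last by rewrite /= in_itv/= andbT; apply/negP; rewrite -leNgt.
  by rewrite /kw_core gneg// !(mulr0, mul0r) normr0.
rewrite mem_set; last by rewrite /= in_itv/= andbT.
by rewrite ger0_norm// mulr_ge0// ltW.
Qed.

Lemma kw_cdf_gt0 (R : realType) (u a b : R) : 0 < a -> 0 < b -> 0 < u <= 1 ->
  0 < 1 - (1 - u `^ a) `^ b.
Proof.
move=> a0 b0 /andP[u0 u1]; rewrite subr_gt0.
have ua : 0 < u `^ a <= 1.
  rewrite powR_gt0//=; apply: (@le_trans _ _ (1 `^ a)); last by rewrite powR1.
  by apply: ge0_ler_powR; rewrite ?nnegrE// ltW.
apply: (@lt_le_trans _ _ (1 `^ b)); last by rewrite powR1.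
by apply: gt0_ltr_powR; rewrite ?nnegrE//; move/andP: ua => [? ?]; lra.
Qed.

Lemma kw_surv_nonincreasing (R : realType) (u v a b : R) :
  0 < a -> 0 < b -> 0 <= u -> u <= v -> v <= 1 ->
  (1 - v `^ a) `^ b <= (1 - u `^ a) `^ b.
Proof.
move=> a0 b0 u0 uv v1; have v0 := le_trans u0 uv.
have uva : u `^ a <= v `^ a by apply: ge0_ler_powR; rewrite ?nnegrE// ltW.
have va1 : v `^ a <= 1.
  apply: (@le_trans _ _ (1 `^ a)); last by rewrite powR1.
  by apply: ge0_ler_powR; rewrite ?nnegrE// ltW.
by apply: ge0_ler_powR; rewrite ?nnegrE ?(ltW b0)//; lra.
Qed.

Lemma ler_norm_ratio (R : realFieldType) (x c y D B : R) (k : nat) :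
  0 <= x -> 0 <= c -> 0 < D -> D <= y -> B != 0 ->
  x * c <= `|B| / D ^+ k * `|x * (c * y ^+ k / B)|.
Proof.
move=> x0 c0 D0 Dy B0; have y0 := lt_le_trans D0 Dy.
have xc0 := mulr_ge0 x0 c0.
rewrite !mulrA normrM normfV ger0_norm; last by rewrite mulr_ge0// exprn_ge0// ltW.
rewrite [leRHS](_ : _ = x * c * (y ^+ k / D ^+ k)); last first.
  by field; rewrite normr_eq0 B0 expf_neq0// gt_eqF.
rewrite ler_peMr// ler_pdivlMr ?exprn_gt0// mul1r.
by rewrite lerXn2r// nnegrE ltW.
Qed.

Lemma integral_lincomb (R : realType) (k : nat) (c : nat -> R)
    (K : nat -> R -> R) :
  (forall l, (l < k)%N ->
     lebesgue_measure.-integrable [set: R] (EFin \o K l)) ->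
  (\int[lebesgue_measure]_t (\sum_(l < k) c l * K l t)%:E =
   \sum_(0 <= l < k) (c l)%:E * \int[lebesgue_measure]_t (K l t)%:E)%E.
Proof.
move=> iK; rewrite big_mkord.
have icK (l : 'I_k) :
    lebesgue_measure.-integrable [set: R] (fun t => (c l)%:E * (K l t)%:E)%E.
  by apply: integrableZl => //; exact: iK.
under eq_integral do rewrite -sumEFin; rewrite integral_sum//.
by apply: eq_bigr => l _; exact: (integralZl measurableT (iK _ (ltn_ord l))).
Qed.

(** Domination by [t0 ^+ s * core t + C * `|f t|], where [f] is t ^+ s times the
    BKw-G density and G t0 > 0. The first summand serves for t <= t0. For
    t > t0, 1 - S is at least its value D > 0 at t0, so the factor
    (1 - S) ^+ (M - 1) of [f] is at least D ^+ (M - 1). *)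
Lemma integrable_kw_term (R : realType) (G : cumulativeBounded (0 : R) (1 : R))
    (g : R -> R) (a b n : R) (M s j : nat) :
  measurable_fun [set: R] g -> (forall t, 0 <= g t) ->
  (forall t : R, t <= 0 -> g t = 0) ->
  {ae (@lebesgue_measure R), forall t : R, 0 < t ->
     is_derive (t : R^o) (1 : R^o) (G : R^o -> R^o) (g t)} ->
  0 < a -> 0 < b -> 0 < n -> (0 < M)%N -> Beta M%:R n != 0 ->
  lebesgue_measure.-integrable [set: R]
    (fun t => (t ^+ s * bkwg_pdf G g a b M%:R n t)%:E) ->
  lebesgue_measure.-integrable [set: R]
    (EFin \o kw_term G g a b s 0 (j%:R + n - 1)).
Proof.
move=> mg g0 gneg DG a0 b0 n0 M0 B0 if_.
have ndG := cumulative_is_nondecreasing G.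
have mG : measurable_fun [set: R] G by exact: nondecreasing_measurable.
have [t0 t00 Gt0] : exists2 t0 : R, 0 < t0 & 0 < G t0.
  have : \forall t \near +oo, 0 < t /\ 0 < G t.
    near=> t; split; first by near: t; exact: nbhs_pinfty_gt.
    by near: t; apply: (cvgr_gt _ (cumulativey G)).
  by move=> /filter_ex[t [? ?]]; exists t.
set D := 1 - (1 - G t0 `^ a) `^ b.
have D0 : 0 < D by apply: kw_cdf_gt0 => //; rewrite Gt0; case/andP: (cdf_itv G t0).
pose C := `|Beta M%:R n| / D ^+ M.-1.
have C0 : 0 <= C by rewrite divr_ge0// exprn_ge0// ltW.
pose f t := t ^+ s * bkwg_pdf G g a b M%:R n t.
pose core := kw_core G g a b n.
have core0 t : 0 <= core t by exact: kw_core_ge0.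
have t0s : 0 <= t0 ^+ s by rewrite exprn_ge0// ltW.
have B_ge0 t : 0 <= t0 ^+ s * core t + C * `|f t|.
  by apply: addr_ge0; apply: mulr_ge0.
have iB : lebesgue_measure.-integrable [set: R]
    (fun t => (t0 ^+ s * core t + C * `|f t|)%:E).
  have -> : (fun t => (t0 ^+ s * core t + C * `|f t|)%:E) =
      ((fun t => (t0 ^+ s)%:E * (core t)%:E) \+
       (fun t => C%:E * `|(f t)%:E|))%E.
    by apply/funext => t; rewrite /= EFinD !EFinM.
  apply: integrableD => //; apply: integrableZl => //.
    exact: (integrable_kw_core mg g0 gneg DG).
  exact: integrable_abse.
have mB : measurable_fun [set: R] (fun t => (t0 ^+ s * core t + C * `|f t|)%:E).
  by case/integrableP : iB.
have mK := measurable_kw_term a b s 0 (j%:R + n - 1) mG mg.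
apply/integrableP; split; first exact/measurable_EFinP.
apply: le_lt_trans (integrable_lty measurableT iB).
apply: ae_ge0_le_integral => //.
- by apply/measurable_EFinP; exact: measurableT_comp.
- by move=> t _; rewrite lee_fin; exact: B_ge0.
have := ae_pdf_support gneg DG; apply: ae_lebesgueS => t supp _.
rewrite lee_fin.
case: supp => [gt0|[tpos G01 _]].
  rewrite [kw_term _ _ _ _ _ _ _ _]/kw_term gt0 !(mulr0, mul0r) normr0.
  exact: B_ge0.
have [/andP[y0 _] /andP[w0 w1]] := kw_surv_itv a0 b0 G01.
set w := (1 - G t `^ a) `^ b in w0 w1.
have termE : kw_term G g a b s 0 (j%:R + n - 1) t = t ^+ s * (w ^+ j * core t).
  rewrite kw_term_split//; last by right.
  congr (_ * _); rewrite /core /kw_core !(powR_split _ _ y0) -/w.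
  by rewrite -addrA (powR_natD _ _ w0); ring.
have ts0 : 0 <= t ^+ s by rewrite exprn_ge0// ltW.
have term_le : `|kw_term G g a b s 0 (j%:R + n - 1) t| <= t ^+ s * core t.
  rewrite termE ger0_norm; last first.
    by apply: mulr_ge0 => //; apply: mulr_ge0 => //; apply: exprn_ge0; exact: ltW.
  by rewrite ler_wpM2l// ler_piMl// exprn_ile1// ltW.
apply: (le_trans term_le).
have [tt0|t0t] := leP t t0.
  apply: ler_wpDr; first exact: mulr_ge0.
  by apply: ler_wpM2r => //; rewrite lerXn2r// nnegrE ltW.
apply: ler_wpDl; first exact: mulr_ge0.
have DW : D <= 1 - w.
  rewrite lerD2l lerN2; apply: kw_surv_nonincreasing => //; first exact: ltW.
    exact/ndG/ltW.
  by case/andP: G01 => _ /ltW.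
have -> : f t = t ^+ s * (core t * (1 - w) ^+ M.-1 / Beta M%:R n).
  by rewrite /f bkwg_pdf_core//; right.
exact (ler_norm_ratio M.-1 ts0 (core0 t) D0 DW B0).
Unshelve. all: by end_near. Qed.

(** Otherwise division by zero would make the density vanish everywhere, and its
    integral would not be 1. *)
Lemma Beta_neq0 (R : realType) (d : measure_display)
    (Omega : measurableType d) (P : probability Omega R) (T : {RV P >-> R})
    (G g : R -> R) (a b m n : R) :
  is_pdf (distribution P T) (bkwg_pdf G g a b m n) -> Beta m n != 0.
Proof.
move=> [_ _ /(_ setT measurableT)]; apply: contra_eqN => /eqP B0.
rewrite probability_setT integral0_eq ?gt_eqF// => t _.
by rewrite /bkwg_pdf B0 invr0 mulr0; case: ifP.
Qed.

(** * The moment formulas *)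

Theorem mainTheorem5 (R : realType)
  (G : cumulativeBounded (0 : R) (1 : R)) (g : R -> R)
  (hGpdf : is_pdf (lebesgue_stieltjes_measure G) g)
  (hgpos : forall t : R, t <= 0 -> g t = 0)
  (hGg : {ae (@lebesgue_measure R), forall t : R, 0 < t ->
            is_derive (t : R^o) (1 : R^o) (G : R^o -> R^o) (g t)})
  (a b m n : R) (ha : 0 < a) (hb : 0 < b) (hm : 0 < m) (hn : 0 < n)
  (d : measure_display) (Omega : measurableType d) (P : probability Omega R)
  (T : {RV P >-> R})
  (hT : is_pdf (distribution P T) (bkwg_pdf G g a b m n))
  (s : nat) :
  (forall (p : nat) (q r : R),
     kw_Gamma G g a b p q r =
       pwm (kw_cdf G a b) (kw_pdf G g a b) p q r) /\
  (forall M : nat, m = M%:R ->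
     P.-integrable [set: Omega] (fun w => (T w ^+ s)%:E) ->
     'E_P[fun w => (T w ^+ s)%R]%E =
       (\sum_(0 <= j < M)
          (bkw_beta m n j)%:E * kw_Gamma G g a b s 0 (j%:R + n - 1))%E) /\
  (forall M N : nat, m = M%:R -> n = N%:R ->
     (forall l : nat, (l <= M + N - 2)%N ->
        (kw_Gamma G g a b s l%:R 0 < +oo)%E) ->
     'E_P[fun w => (T w ^+ s)%R]%E =
       (\sum_(0 <= l < (M + N - 2).+1)
          (bkw_eta M n l)%:E * kw_Gamma G g a b s l%:R 0)%E).
Proof.
have [mg g0 _] := hGpdf.
have mG : measurable_fun [set: R] G.
  by apply: nondecreasing_measurable => //; exact: cumulative_is_nondecreasing.
have [mf _ _] := hT.
have B0 := Beta_neq0 hT.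
have [momE momI] := moment_pdf s hT.
have supp := ae_pdf_support hgpos hGg.
have mmom : measurable_fun [set: measurableTypeR R]
    (fun t => (t ^+ s * bkwg_pdf G g a b m n t)%:E).
  by apply/measurable_EFinP; apply: measurable_funM => //; exact: measurable_funX.
have mcomb (k : nat) (c : nat -> R) (K : nat -> R -> R) :
    (forall l, measurable_fun [set: R] (K l)) ->
    measurable_fun [set: measurableTypeR R]
      (fun t => (\sum_(l < k) c l * K l t)%:E).
  move=> mK; apply/measurable_EFinP; apply: measurable_sum => l.
  by apply: measurable_funM => //; exact: mK.
split; [|split].
- move=> p q r; rewrite /kw_Gamma /pwm; apply: eq_integral => t _.
  by rewrite /kw_cdf /kw_pdf subKr.
- move=> M mM iT; subst m; have M0 : (0 < M)%N by rewrite -(ltr0n R).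
  pose K (j : nat) := kw_term G g a b s 0 (j%:R + n - 1).
  have iK j (_ : (j < M)%N) : lebesgue_measure.-integrable [set: R] (EFin \o K j).
    exact: (integrable_kw_term j mg g0 hgpos hGg ha hb hn M0 B0 (momI iT)).
  rewrite momE.
  transitivity (\int[lebesgue_measure]_t
      (\sum_(j < M) bkw_beta M%:R n j * K j t)%:E)%E; last first.
    by rewrite (integral_lincomb (bkw_beta M%:R n) iK).
  apply: ae_eq_integral => //.
    by apply: (mcomb _ (bkw_beta M%:R n) K) => l; exact: measurable_kw_term.
  move: supp; apply: ae_lebesgueS => t gt _; congr EFin.
  by apply: bkwg_expand => //; case: gt => [|[]]; [left|right].
- move=> M N mM nN fin; subst m n.
  have M0 : (0 < M)%N by rewrite -(ltr0n R).
  have N0 : (0 < N)%N by rewrite -(ltr0n R).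
  pose K (l : nat) := kw_term G g a b s l%:R 0.
  have mK l : measurable_fun [set: R] (K l) by exact: measurable_kw_term.
  have K0 l t : 0 <= K l t.
    have [/hgpos gt0|tpos] := leP t 0.
      by rewrite /K /kw_term gt0 !(mulr0, mul0r).
    by rewrite /K /kw_term !mulr_ge0 ?powR_ge0 ?exprn_ge0// ltW.
  have iK l (_ : (l < (M + N - 2).+1)%N) :
      lebesgue_measure.-integrable [set: R] (EFin \o K l).
    apply/integrableP; split; first by apply/measurable_EFinP; exact: mK.
    under eq_integral do rewrite /= ger0_norm//.
    exact: fin.
  rewrite momE.
  transitivity (\int[lebesgue_measure]_t
      (\sum_(l < (M + N - 2).+1) bkw_eta M N%:R l * K l t)%:E)%E; last first.
    by rewrite (integral_lincomb (bkw_eta M N%:R) iK).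
  apply: ae_eq_integral => //; first exact: (mcomb _ (bkw_eta M N%:R) K).
  move: supp; apply: ae_lebesgueS => t gt _; congr EFin.
  by apply: bkwg_expand_nat => //; case: gt => [|[]]; [left|right].
Qed.
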